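(* Let $K$ be a $^*$-continuous KAT with top, $A$ a top Kleene abstract domain of $K$ with maps $\alpha,\gamma$, and $T_{\Sigma,B}$ a KAT language interpreted on $K$ through a pair-valued evaluation. Let $t\in T_{\Sigma,B}$ be such that for every atom $\mathtt a$ occurring in $t$, $A$ is globally complete for both $\llbracket\mathtt a\rrbracket_{ok}$ and $\llbracket\mathtt a\rrbracket_{err}$. For all $a,b,c\in K$, if $[a]\,t\,[ok:b][err:c]$ is valid, then it is derivable in $\mathrm{LCTIL}_A$.
   Context: Idempotent semiring: $(K,+,0)$ commutative monoid with $a+a=a$, $(K,\cdot,1)$ monoid, two-sided distributivity, $0a=a0=0$; $a\le b$ iff $a+b=b$. KAT: idempotent semiring with Boolean subalgebra $\mathrm{Test}(K)$ (join $+$, meet $\cdot$, complement, bottom $0$, top $1$) and ${}^*$ with $1+aa^*\le a^*$, $1+a^*a\le a^*$, $b+ac\le c\Rightarrow a^*b\le c$, $b+ca\le c\Rightarrow ba^*\le c$. TopKAT: KAT with greatest element $\top$; $^*$-continuous: $\bigvee_nab^nc$ exists and equals $ab^*c$ for all $a,b,c$. $\mathrm{TOP}(K)=\{\top a\mid a\in K\}$. Language: disjoint $\Sigma,B$ ($\mathtt0,\mathtt1\in B$), $\mathrm{Atom}=\Sigma\cup B$, terms $t::=\mathtt a\mid\mathtt0\mid\mathtt1\mid t_1+t_2\mid t_1\cdot t_2\mid t^*$. Evaluation $u:\mathrm{Atom}\to K\times K$ induces $\llbracket t\rrbracket=(\llbracket t\rrbracket_{ok},\llbracket t\rrbracket_{err})$: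 $\llbracket\mathtt a\rrbracket=u(\mathtt a)$; $\llbracket t_1+t_2\rrbracket$ componentwise sum; $\llbracket t_1\cdot t_2\rrbracket=(\llbracket t_1\rrbracket_{ok}\llbracket t_2\rrbracket_{ok},\llbracket t_1\rrbracket_{err}+\llbracket t_1\rrbracket_{ok}\llbracket t_2\rrbracket_{err})$; $\llbracket t^*\rrbracket=(\llbracket t\rrbracket_{ok}^*,\llbracket t\rrbracket_{ok}^*\llbracket t\rrbracket_{err})$. Top Kleene abstract domain: poset $A$, Galois insertion $\alpha:\mathrm{TOP}(K)\to A$, $\gamma:A\to\mathrm{TOP}(K)$ ($\alpha(x)\le_Ay\iff x\le\gamma(y)$, $\alpha\gamma=\mathrm{id}$), countably complete. Abstract semantics ($\varepsilon\in\{ok,err\}$): $\mathcal S^\sharp_\varepsilon[\mathtt c]x=\alpha(\gamma(x)\llbracket\mathtt c\rrbracket_\varepsilon)$; $\mathcal S^\sharp_\varepsilon[t_1+t_2]x=\mathcal S^\sharp_\varepsilon[t_1]x\vee_A\mathcal S^\sharp_\varepsilon[t_2]x$; $\mathcal S^\sharp_{ok}[t_1\cdot t_2]x=\mathcal S^\sharp_{ok}[t_2](\mathcal S^\sharp_{ok}[t_1]x)$; $\mathcal S^\sharp_{err}[t_1\cdot t_2]x=\mathcal S^\sharp_{err}[t_1]x\vee_A\mathcal S^\sharp_{err}[t_2](\mathcal S^\sharp_{ok}[t_1]x)$; $\mathcal S^\sharp_{ok}[t^*]x=\bigvee_n(\mathcal S^\sharp_{ok}[t])^nx$; $\mathcal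 S^\sharp_{err}[t^*]x=\mathcal S^\sharp_{err}[t](\bigvee_n(\mathcal S^\sharp_{ok}[t])^nx)$. $A(x):=\gamma\alpha(x)$; $\mathbb C^A_b(c)$ iff $A(\top bc)=A(A(\top b)c)$; $A$ is globally complete for $c$ iff $\mathbb C^A_b(c)$ for every $b\in K$. Triples $[a]t[\varepsilon:b]$, valid iff $\top b\le\top a\llbracket t\rrbracket_\varepsilon$ and $\mathcal S^\sharp_\varepsilon[t]\alpha(\top a)=\alpha(\top b)=\alpha(\top a\llbracket t\rrbracket_\varepsilon)$; $[a]t[ok:b][err:c]$ is valid (derivable) iff both $[a]t[ok:b]$ and $[a]t[err:c]$ are. $\mathrm{LCTIL}_A$ rules ($\varepsilon$-rules are schemes for each $\varepsilon$): (transfer) $\mathtt c\in\mathrm{Atom}$, $\mathbb C^A_a(\llbracket\mathtt c\rrbracket_{ok})$, $\mathbb C^A_a(\llbracket\mathtt c\rrbracket_{err})$ $\vdash[a]\mathtt c[ok:a\llbracket\mathtt c\rrbracket_{ok}][err:a\llbracket\mathtt c\rrbracket_{err}]$; (relax) $\top a'\le\top a\le A(\top a')$, $[a']t[\varepsilon:b']$, $\top b\le\top b'\le A(\top b)$ $\vdash[a]t[\varepsilon:b]$; (seq-ok) $[a]t_1[ok:r]$, $[r]t_2[ok:b]$ $\vdash[a]t_1\cdot t_2[ok:b]$; (seq-err) $[a]t_1[ok:b][err:r]$, $[b]t_2[err:s]$ $\vdash[a]t_1\cdot t_2[err:r+s]$; (rec-err) $[a]t^*[ok:b]$, $[b]t[err:r]$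 $\vdash[a]t^*[err:r]$; (join) $[a]t_1[\varepsilon:b_1]$, $[a]t_2[\varepsilon:b_2]$ $\vdash[a]t_1+t_2[\varepsilon:b_1+b_2]$; (limit) $[a_n]t[ok:a_{n+1}]$ for all $n$ $\vdash[a_0]t^*[ok:\bigvee_na_n]$, applicable only when $\bigvee_na_n$ exists and $\top\bigvee_na_n=\bigvee_n\top a_n$. *)

(* Defs.v *)
From HB Require Import structures.
From mathcomp Require Import all_boot all_order all_algebra.
From mathcomp Require Import boolp classical_sets cardinality.

Set Implicit Arguments.
Unset Strict Implicit.
Unset Printing Implicit Defensive.

Import GRing.Theory.

Local Open Scope classical_set_scope.
Local Open Scope ring_scope.

Definition kle (K : pzSemiRingType) (a b : K) : Prop := a + b = b.

Definition is_lub (K : pzSemiRingType) (x : nat -> K) (s : K) : Prop :=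
  (forall n, kle (x n) s) /\
  (forall y, (forall n, kle (x n) y) -> kle s y).

(* The Boolean operations of Test(K) are those of K, so only closure, the
   complement laws, and commutativity and idempotence of the meet are listed:
   p <= 1, absorption and both distributive laws follow. The value of [compl]
   outside [test] is irrelevant. *)
HB.mixin Record PzSemiRing_isKAT K of GRing.PzSemiRing K := {
  addkk : forall a : K, a + a = a;
  test : set K;
  compl : K -> K;
  test0 : test 0;
  test1 : test 1;
  testD : forall p q, test p -> test q -> test (p + q);
  testM : forall p q, test p -> test q -> test (p * q);
  testC : forall p, test p -> test (compl p);
  test_mulC : forall p q, test p -> test q -> p * q = q * p;
  test_mulpp : forall p, test p -> p * p = p;
  test_addC : forall p, test p -> p + compl p = 1;
  test_mulCr : forall p, test p -> p * compl p = 0;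
  star : K -> K;
  star_unfoldl : forall a, kle (1 + a * star a) (star a);
  star_unfoldr : forall a, kle (1 + star a * a) (star a);
  star_indl : forall a b c, kle (b + a * c) c -> kle (star a * b) c;
  star_indr : forall a b c, kle (b + c * a) c -> kle (b * star a) c
}.

#[short(type="katType")]
HB.structure Definition KAT := {K of PzSemiRing_isKAT K & GRing.PzSemiRing K}.

HB.mixin Record KAT_isTopKAT K of KAT K := {
  ktop : K;
  kle_top : forall a : K, kle a ktop
}.

#[short(type="topKatType")]
HB.structure Definition TopKAT := {K of KAT_isTopKAT K & KAT K}.

Definition star_continuous (K : katType) : Prop :=
  forall a b c : K, is_lub (fun n => a * b ^+ n * c) (a * star b * c).

Definition TOP (K : topKatType) : set K := range (fun a : K => ktop * a).
Arguments TOP : clear implicits.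

Lemma TOP_top (K : topKatType) (a : K) : ktop * a \in TOP K.
Proof. by apply/mem_set; exists a. Qed.

Lemma TOP_mul (K : topKatType) (x : TOP K) (c : K) : val x * c \in TOP K.
Proof.
by case: x => x /= /set_mem[a _ <-]; apply/mem_set; exists (a * c); rewrite // mulrA.
Qed.

Definition topl (K : topKatType) (a : K) : TOP K :=
  exist (fun x => x \in TOP K) (ktop * a) (TOP_top a).

Definition topmul (K : topKatType) (x : TOP K) (c : K) : TOP K :=
  exist (fun x => x \in TOP K) (val x * c) (TOP_mul x c).

Record top_kleene_domain (K : topKatType) (d : Order.disp_t)
    (A : porderType d) := TopKleeneDomain {
  alpha : TOP K -> A;
  gamma : A -> TOP K;
  galois : forall (x : TOP K) (y : A),
    (alpha x <= y)%O <-> kle (val x) (val (gamma y));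
  alphaK : forall y : A, alpha (gamma y) = y;
  countably_complete : forall X : set A, countable X -> supremums X !=set0
}.

Record kat_language := KatLanguage {
  action : Type;
  btest : Type;
  btest0 : btest;
  btest1 : btest
}.

Definition atom (L : kat_language) : Type := (action L + btest L)%type.

(* The constants 0 and 1 are atoms: see [tzero] and [tone]. *)
Inductive term (L : kat_language) : Type :=
| Atm of atom L
| Plus of term L & term L
| Seq of term L & term L
| Star of term L.

Definition tzero (L : kat_language) : term L := Atm (inr (btest0 L)).
Definition tone (L : kat_language) : term L := Atm (inr (btest1 L)).

Fixpoint occurs (L : kat_language) (c : atom L) (t : term L) : Prop :=
  match t with
  | Atm c' => c = c'
  | Plus t1 t2 | Seq t1 t2 => occurs c t1 \/ occurs c t2
  | Star t1 => occurs c t1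
  end.

Inductive outcome : Type := ok | err.

Section Semantics.
Variables (K : topKatType) (L : kat_language) (u : atom L -> K * K).

Fixpoint eval (t : term L) : K * K :=
  match t with
  | Atm c => u c
  | Plus t1 t2 => ((eval t1).1 + (eval t2).1, (eval t1).2 + (eval t2).2)
  | Seq t1 t2 =>
      ((eval t1).1 * (eval t2).1, (eval t1).2 + (eval t1).1 * (eval t2).2)
  | Star t1 => (star (eval t1).1, star (eval t1).1 * (eval t1).2)
  end.

Definition sem (e : outcome) (t : term L) : K :=
  match e with ok => (eval t).1 | err => (eval t).2 end.

Variables (d : Order.disp_t) (A : porderType d) (D : top_kleene_domain K A).

(* [supremum] needs a default value; it is never used below, where [asup] is
   only applied to nonempty countable sets. *)
Definition asup (X : set A) : A := supremum (alpha D (topl 0)) X.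

Definition ajoin (x y : A) : A := asup [set x; y].

Fixpoint abs_sem (t : term L) (e : outcome) (x : A) : A :=
  match t with
  | Atm c => alpha D (topmul (gamma D x) (sem e (Atm c)))
  | Plus t1 t2 => ajoin (abs_sem t1 e x) (abs_sem t2 e x)
  | Seq t1 t2 =>
      match e with
      | ok => abs_sem t2 ok (abs_sem t1 ok x)
      | err => ajoin (abs_sem t1 err x) (abs_sem t2 err (abs_sem t1 ok x))
      end
  | Star t1 =>
      let s := asup (range (fun n : nat => iter n (abs_sem t1 ok) x)) in
      match e with
      | ok => s
      | err => abs_sem t1 err s
      end
  end.

Definition aclos (x : TOP K) : TOP K := gamma D (alpha D x).

Definition locally_complete (b c : K) : Prop :=
  aclos (topl (b * c)) = aclos (topmul (aclos (topl b)) c).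

Definition globally_complete (c : K) : Prop :=
  forall b : K, locally_complete b c.

Definition valid (a : K) (t : term L) (e : outcome) (b : K) : Prop :=
  [/\ kle (ktop * b) (ktop * a * sem e t),
      abs_sem t e (alpha D (topl a)) = alpha D (topl b)
    & alpha D (topl b) = alpha D (topmul (topl a) (sem e t))].

Inductive derivable : K -> term L -> outcome -> K -> Prop :=
| d_transfer (a : K) (c : atom L) (e : outcome) :
    locally_complete a (sem ok (Atm c)) ->
    locally_complete a (sem err (Atm c)) ->
    derivable a (Atm c) e (a * sem e (Atm c))
| d_relax (a a' b b' : K) (t : term L) (e : outcome) :
    kle (ktop * a') (ktop * a) ->
    kle (ktop * a) (val (aclos (topl a'))) ->
    derivable a' t e b' ->
    kle (ktop * b) (ktop * b') ->
    kle (ktop * b') (val (aclos (topl b))) ->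
    derivable a t e b
| d_seq_ok (a r b : K) (t1 t2 : term L) :
    derivable a t1 ok r ->
    derivable r t2 ok b ->
    derivable a (Seq t1 t2) ok b
| d_seq_err (a b r s : K) (t1 t2 : term L) :
    derivable a t1 ok b ->
    derivable a t1 err r ->
    derivable b t2 err s ->
    derivable a (Seq t1 t2) err (r + s)
| d_rec_err (a b r : K) (t : term L) :
    derivable a (Star t) ok b ->
    derivable b t err r ->
    derivable a (Star t) err r
| d_join (a b1 b2 : K) (t1 t2 : term L) (e : outcome) :
    derivable a t1 e b1 ->
    derivable a t2 e b2 ->
    derivable a (Plus t1 t2) e (b1 + b2)
| d_limit (x : nat -> K) (s : K) (t : term L) :
    (forall n, derivable (x n) t ok (x n.+1)) ->
    is_lub x s ->
    is_lub (fun n => ktop * x n) (ktop * s) ->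
    derivable (x 0%N) (Star t) ok s.

Definition valid2 (a : K) (t : term L) (b c : K) : Prop :=
  valid a t ok b /\ valid a t err c.

Definition derivable2 (a : K) (t : term L) (b c : K) : Prop :=
  derivable a t ok b /\ derivable a t err c.

End Semantics.

(* Main.v *)
(** Global completeness makes (transfer) applicable to every precondition, so
    the triple [a] t [e : a * sem e t] with the exact postcondition is derivable
    by induction on [t]; for [Star t], *-continuity provides both suprema
    required by (limit) along the chain a * (sem ok t)^n.  A valid
    postcondition has the same closure as the exact one and lies below it, so
    (relax) leads from the exact one to it. *)

Require Import Defs.
From mathcomp Require Import all_boot all_order all_algebra.
From mathcomp Require Import boolp classical_sets.

Set Implicit Arguments.
Unset Strict Implicit.
Unset Printing Implicit Defensive.

Import GRing.Theory.
Local Open Scope ring_scope.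

Lemma is_lub_mul_star (K : katType) (a b : K) :
  star_continuous K -> is_lub (fun n => a * b ^+ n) (a * star b).
Proof.
by move=> /(_ a b 1); under eq_fun do rewrite mulr1; rewrite mulr1.
Qed.

Lemma topmul_topl (K : topKatType) (a c : K) :
  topmul (topl a) c = topl (a * c).
Proof. by apply: val_inj; rewrite /= mulrA. Qed.

Section Closure.
Variables (K : topKatType) (d : Order.disp_t) (A : porderType d).
Variable D : top_kleene_domain K A.

Lemma kle_aclos (x : TOP K) : kle (val x) (val (aclos D x)).
Proof. by apply/(galois D). Qed.

Lemma kle_aclos_eq_alpha (x y : TOP K) :
  alpha D x = alpha D y -> kle (val x) (val (aclos D y)).
Proof. by rewrite /aclos => <-; exact: kle_aclos. Qed.

End Closure.

Section Derivations.
Variables (K : topKatType) (d : Order.disp_t) (A : porderType d).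
Variables (D : top_kleene_domain K A) (L : kat_language) (u : atom L -> K * K).

Lemma derivable_relax_post (a b b' : K) (t : term L) (e : outcome) :
  kle (ktop * b) (ktop * b') -> alpha D (topl b) = alpha D (topl b') ->
  derivable u D a t e b' -> derivable u D a t e b.
Proof.
move=> le_bb' eq_alpha der_b'; apply: (d_relax _ _ der_b' le_bb').
- exact: addkk.
- exact: (kle_aclos D (topl a)).
- exact: (kle_aclos_eq_alpha (esym eq_alpha)).
Qed.

Lemma derivable_of_valid (a b : K) (t : term L) (e : outcome) :
  derivable u D a t e (a * sem u e t) -> valid u D a t e b ->
  derivable u D a t e b.
Proof.
move=> der_exact [le_b _]; rewrite topmul_topl => eq_alpha.
by apply: derivable_relax_post eq_alpha der_exact; rewrite mulrA.
Qed.

Definition exactly_derivable (t : term L) : Prop :=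
  forall (a : K) (e : outcome), derivable u D a t e (a * sem u e t).

Lemma exactly_derivable_Atm (c : atom L) :
  globally_complete D (sem u ok (Atm c)) ->
  globally_complete D (sem u err (Atm c)) ->
  exactly_derivable (Atm c).
Proof. by move=> complete_ok complete_err a e; exact: d_transfer. Qed.

Lemma exactly_derivable_Plus (t1 t2 : term L) :
  exactly_derivable t1 -> exactly_derivable t2 ->
  exactly_derivable (Plus t1 t2).
Proof.
move=> exact1 exact2 a e.
have -> : sem u e (Plus t1 t2) = sem u e t1 + sem u e t2 by case: e.
by rewrite mulrDr; apply: d_join; [exact: exact1 | exact: exact2].
Qed.

Lemma exactly_derivable_Seq (t1 t2 : term L) :
  exactly_derivable t1 -> exactly_derivable t2 ->
  exactly_derivable (Seq t1 t2).
Proof.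
move=> exact1 exact2 a [] /=.
- by rewrite mulrA; exact: d_seq_ok (exact1 a ok) (exact2 _ ok).
- rewrite mulrDr mulrA.
  exact: d_seq_err (exact1 a ok) (exact1 a err) (exact2 _ err).
Qed.

Hypothesis contK : star_continuous K.

Lemma derivable_star_ok (a b : K) (t : term L) :
  (forall n, derivable u D (a * b ^+ n) t ok (a * b ^+ n.+1)) ->
  derivable u D a (Star t) ok (a * star b).
Proof.
move=> der_chain.
have -> : derivable u D a = derivable u D (a * b ^+ 0) by rewrite expr0 mulr1.
apply: (d_limit (x := fun n => a * b ^+ n) der_chain).
- exact: is_lub_mul_star.
- by under eq_fun do rewrite mulrA; rewrite mulrA; exact: is_lub_mul_star.
Qed.

Lemma exactly_derivable_Star (t : term L) :
  exactly_derivable t -> exactly_derivable (Star t).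
Proof.
move=> exact_t a.
have der_ok : derivable u D a (Star t) ok (a * star (sem u ok t)).
  apply: derivable_star_ok => n.
  by rewrite exprSr mulrA; exact: exact_t.
case=> //=; rewrite mulrA; exact: d_rec_err der_ok (exact_t _ err).
Qed.

Lemma exactly_derivable_term (t : term L) :
  (forall c, occurs c t -> exactly_derivable (Atm c)) -> exactly_derivable t.
Proof.
elim: t => [c|t1 IH1 t2 IH2|t1 IH1 t2 IH2|t IH] exact_atoms.
- exact: exact_atoms.
- apply: exactly_derivable_Plus; [apply: IH1 | apply: IH2] => c occ_c.
  + by apply: exact_atoms; left.
  + by apply: exact_atoms; right.
- apply: exactly_derivable_Seq; [apply: IH1 | apply: IH2] => c occ_c.
  + by apply: exact_atoms; left.
  + by apply: exact_atoms; right.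
- by apply: exactly_derivable_Star; exact: IH.
Qed.

End Derivations.

Theorem theorem13 (K : topKatType) (HK : star_continuous K)
    (d : Order.disp_t) (A : porderType d) (D : top_kleene_domain K A)
    (L : kat_language) (u : atom L -> K * K) (t : term L)
    (Ht : forall c : atom L, occurs c t ->
       globally_complete D (sem u ok (Atm c)) /\
       globally_complete D (sem u err (Atm c)))
    (a b c : K) :
  valid2 u D a t b c -> derivable2 u D a t b c.
Proof.
have exact_t : exactly_derivable D u t.
  apply: exactly_derivable_term => // atm /Ht[complete_ok complete_err].
  exact: exactly_derivable_Atm.
by case=> valid_ok valid_err; split;
  apply: (derivable_of_valid (exact_t a _)).
Qed.
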